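(* Let $P$ be a finite poset, let $Q$ be either the order polytope $\mathcal{O}(P)$ or the chain polytope $\mathcal{C}(P)$ of $P$, and let $d$ be the dimension of $Q$. Then $f_0(Q)f_{d-1}(Q)\leq d2^{d+1}$, and equality holds if and only if $Q$ is affinely isomorphic to the $d$-dimensional cube or the $d$-dimensional cross-polytope.
   Context: For a $d$-dimensional polytope $Q$, $f_0(Q)$ is its number of vertices and $f_{d-1}(Q)$ its number of facets. Convention for $d=0$: a point has no facets, so the product is $0$, and the $0$-dimensional cube and cross-polytope are points. The $d$-dimensional cube is $[-1,1]^d$ and the $d$-dimensional cross-polytope is its polar. For a finite poset $P$ with order relation $\preceq$, $$\mathcal{O}(P)=\{x\in[0,1]^P: x_i\geq x_j\text{ whenever } i\preceq j\},$$ $$\mathcal{C}(P)=\Big\{x\in\mathbb{R}_+^P:\sum_{i\in I}x_i\leq 1\text{ for each maximal chain } I\subseteq P\Big\},$$ where $\mathbb{R}_+$ is the set of non-negative reals and a chain is a subset whose elements are pairwise comparable. *)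

(* Defs.v *)
From HB Require Import structures.
From mathcomp Require Import all_boot all_order all_algebra finmap.
From mathcomp Require Import boolp classical_sets functions cardinality reals.

Set Implicit Arguments.
Unset Strict Implicit.
Unset Printing Implicit Defensive.

Import Order.TTheory GRing.Theory Num.Theory.

Local Open Scope classical_set_scope.
Local Open Scope ring_scope.

Section Polytopes.
Context {R : realType}.
Implicit Types V W : vectType R.

Definition affinely_independent {V} k (x : 'I_k.+1 -> V) : bool :=
  free [tuple x (lift ord0 i) - x ord0 | i < k].

(* The dimension of the affine hull of A: the largest k such that A contains
   k + 1 affinely independent points. The value on set0 is the junk value 0. *)
Definition affdim {V} (A : set V) : nat :=
  \max_(k < (\dim {:V}).+1 | `[< exists x : 'I_k.+1 -> V,
      (forall i, A (x i)) /\ affinely_independent x >]) k.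

Definition face {V} (Q F : set V) : Prop :=
  exists (l : {linear V -> R^o}) (c : R),
    (forall x, Q x -> l x <= c) /\ F = Q `&` [set x | l x = c].

(* The face set0 has dimension -1, hence the nonemptiness conditions below,
   needed since affdim set0 = 0. *)
Definition vertices {V} (Q : set V) : set (set V) :=
  [set F | [/\ face Q F, F !=set0 & affdim F = 0%N]].

(* Empty when Q has dimension 0. *)
Definition facets {V} (Q : set V) : set (set V) :=
  [set F | [/\ face Q F, F !=set0 & (affdim F).+1 = affdim Q]].

(* Vertices are counted as 0-dimensional faces. Both sets are finite when Q is
   a polytope (fset_set of an infinite set would be empty). *)
Definition num_vertices {V} (Q : set V) : nat := #|` fset_set (vertices Q)|.

Definition num_facets {V} (Q : set V) : nat := #|` fset_set (facets Q)|.

(* The affine map need not be injective outside A. *)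
Definition affinely_isomorphic {V W} (A : set V) (B : set W) : Prop :=
  exists (L : {linear V -> W}) (b : W), set_bij A B (fun x => L x + b).

Definition polar {n} (A : set 'rV[R]_n) : set 'rV[R]_n :=
  [set y | forall x, A x -> \sum_(i < n) x 0 i * y 0 i <= 1].

End Polytopes.

Definition cube (R : realType) (n : nat) : set 'rV[R]_n :=
  [set x | forall i, -1 <= x 0 i <= 1].
Arguments cube : clear implicits.

Definition cross_polytope (R : realType) (n : nat) : set 'rV[R]_n :=
  polar (cube R n).
Arguments cross_polytope : clear implicits.

Section PosetPolytopes.
Context (R : realType) {disp : Order.disp_t} (P : finPOrderType disp).

Definition order_polytope : set {ffun P -> R^o} :=
  [set x : {ffun P -> R^o} | (forall i, 0 <= (x i : R) <= 1) /\
     (forall i j : P, (i <= j)%O -> (x j : R) <= x i)].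

Definition is_chain (I : {set P}) : bool :=
  [forall i in I, forall j in I, (i >=< j)%O].

Definition chain_polytope : set {ffun P -> R^o} :=
  [set x : {ffun P -> R^o} | (forall i, 0 <= (x i : R)) /\
     (forall I : {set P}, maxset is_chain I -> \sum_(i in I) (x i : R) <= 1)].

End PosetPolytopes.
Arguments order_polytope R {disp} P.
Arguments chain_polytope R {disp} P.

(* Main.v *)
Require Import Defs.
From HB Require Import structures.
From mathcomp Require Import all_boot all_order all_algebra.
From mathcomp Require Import lra zify.

Import Order.TTheory GRing.Theory Num.Theory.

(** Write n = #|P|, and let a and c be the numbers of antichains and of chains
    of P, the empty set counted in both.  Both polytopes are n-dimensional, and
    three bounds combine.

    - Vertices.  Removing from a point x a small multiple of a suitable 0/1
      point of Q and rescaling gives another point of Q; if x is a vertex, it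
      must be that 0/1 point ([vertex_peel]).  Hence every vertex of the order
      polytope is the indicator of the complement of the up-closure of an
      antichain, every vertex of the chain polytope is the indicator of an
      antichain, and Q has at most a vertices.

    - Facets.  A full-dimensional set cut out by m inequalities, all strict at
      some point, has at most m facets ([num_facets_le]).  For the order
      polytope take 0 <= x_i, x_i <= 1 and x_j <= x_i for all i < j; the last
      two kinds are indexed by the pairs i <= j, which correspond to nonempty
      chains with at most two elements.  For the chain polytope take 0 <= x_i
      and one inequality per maximal chain.  The empty chain is not used
      unless P is empty, so Q has at most n + c - 1 facets otherwise.

    - Counting.  c * a <= (n + 1) * 2 ^ n ([card_chains_antichains]): the pairs
      (C, A) of a chain and an antichain with a given union T number at most
      2 * #|T| + 1, and these bounds add up to (n + 1) * 2 ^ n.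

    If P has a strict relation, then a < 2 ^ n and n >= 2, so

      a * (n + c - 1) = a * (n - 1) + a * c
                      < (n - 1) * 2 ^ n + (n + 1) * 2 ^ n = n * 2 ^ (n + 1).

    If P is an antichain, Q is the unit box, an affine cube, with exactly
    2 ^ n vertices and 2 * n facets.  It remains to see that for Q to be an
    affine cube or cross-polytope P must be an antichain: both models are
    centrally symmetric, whereas neither polytope of a poset with a strict
    relation is ([affine_iso_symmetric], [order_symmetric_antichain],
    [chain_symmetric_antichain]). *)

Set Implicit Arguments.
Unset Strict Implicit.
Unset Printing Implicit Defensive.

(** * Chains against antichains *)

Section Count.
Context {disp : Order.disp_t} (P : finPOrderType disp).
Implicit Types (C A T : {set P}).

Definition is_antichain A : bool :=
  [forall i in A, forall j in A, (i >=< j)%O ==> (i == j)].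

Lemma is_chainP C :
  reflect {in C &, forall i j, (i >=< j)%O} (is_chain C).
Proof.
apply: (iffP forall_inP) => [h i j iC jC|h i iC]; first exact: (forall_inP (h i iC)).
by apply/forall_inP => j jC; apply: h.
Qed.

Lemma is_antichainP A :
  reflect {in A &, forall i j, (i >=< j)%O -> i = j} (is_antichain A).
Proof.
apply: (iffP forall_inP) => [h i j iA jA ij|h i iA].
  by have /forall_inP/(_ j jA) := h i iA; rewrite ij => /eqP.
by apply/forall_inP => j jA; apply/implyP => ij; apply/eqP/h.
Qed.

Lemma is_chainS C C' : C' \subset C -> is_chain C -> is_chain C'.
Proof.
move=> /subsetP sC /is_chainP h.
by apply/is_chainP => i j /sC iC /sC jC; apply: h.
Qed.

Lemma is_antichainS A A' : A' \subset A -> is_antichain A -> is_antichain A'.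
Proof.
move=> /subsetP sA /is_antichainP h.
by apply/is_antichainP => i j /sA iA /sA jA; apply: h.
Qed.

Lemma card_all_sets : #|{: {set P}}| = (2 ^ #|P|)%N.
Proof. by rewrite -cardsT -powersetT card_powerset cardsT. Qed.

(** A split partition of T into a chain and an antichain is recorded by its
    chain part. *)
Definition splittings T : {set {set P}} :=
  [set C : {set P} | [&& C \subset T, is_chain C & is_antichain (T :\: C)]].

(** Removing a point x from T maps the splittings of T to those of [T :\ x].
    A splitting of [T :\ x] comes from two splittings of T only if x can be
    added to either part; then its chain consists of the points comparable to
    x, so there is at most one such splitting, and the count grows by at most
    one for each point of T. *)
Lemma card_splittings T : (#|splittings T| <= #|T|.+1)%N.
Proof.
have [n] := ubnP #|T|; elim: n T => // n IH T; rewrite ltnS => leTn.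
have [T0|[x xT]] := set_0Vmem T.
  rewrite T0 cards0; apply: leq_trans (subset_leq_card _) (_ : #|[set set0]| <= 1)%N.
    by apply/subsetP => C; rewrite !inE subset0 => /and3P[].
  by rewrite cards1.
have cardT : #|T| = #|T :\ x|.+1 by rewrite (cardsD1 x) xT.
pose D0 := [set C in splittings T | x \notin C].
pose D1 := [set C :\ x | C in splittings T & x \in C].
have sD0 : D0 \subset splittings (T :\ x).
  apply/subsetP => C; rewrite !inE => /andP[/and3P[CT hC hA] xC].
  rewrite subsetD1 CT xC hC; apply: is_antichainS hA.
  by apply/setSD/subD1set.
have sD1 : D1 \subset splittings (T :\ x).
  apply/subsetP => D /imsetP[C]; rewrite inE => + ->; rewrite !inE => /andP[/and3P[CT hC hA] xC].
  rewrite setSD // (is_chainS (subD1set _ _) hC); apply: is_antichainS hA.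
  apply/subsetP => y; rewrite !inE => /andP[].
  by case: (y == x); rewrite //= => ->.
have cardI : (#|D0 :&: D1| <= 1)%N.
  apply: leq_trans (subset_leq_card _)
    (_ : #|[set [set y in T :\ x | (x >=< y)%O]]| <= 1)%N; last by rewrite cards1.
  apply/subsetP => C0 /setIP[]; rewrite !inE => /andP[/and3P[CT hC hA] xC].
  case/imsetP => C1; rewrite !inE => /andP[/and3P[C1T /is_chainP hC1 hA1] xC1] eC.
  apply/eqP/setP => y; rewrite !inE.
  have [yC|yC] := boolP (y \in C0).
    have yx : y != x by apply: contraNneq xC => <-.
    rewrite yx (subsetP CT) //=; apply/esym/hC1 => //.
    by move: yC; rewrite eC !inE => /andP[].
  case: eqP => //= yx; case: (boolP (y \in T)) => //= yT; apply/esym/negbTE.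
  apply: contra_notN yx => xy; apply/esym.
  by apply: (is_antichainP _ hA) xy; rewrite inE ?xC ?yC.
have -> : #|splittings T| = (#|D0| + #|D1|)%N.
  rewrite -(cardsID [set C : {set P} | x \in C] (splittings T)) addnC; congr (_ + _)%N.
    by apply: eq_card => C; rewrite !inE andbC.
  rewrite card_in_imset => [|C C'].
    by apply: eq_card => C; rewrite !inE.
  by rewrite !inE => /andP[_ xC] /andP[_ xC'] e; rewrite -(setD1K xC) e setD1K.
rewrite -cardsUI cardT -[in X in (_ <= X)%N]addn1 leq_add //.
apply: leq_trans (subset_leq_card _) (IH (T :\ x) _); first by rewrite subUset sD0.
by rewrite -ltnS -cardT.
Qed.

Definition crossings T : {set {set P} * {set P}} :=
  [set p : {set P} * {set P} | [&& is_chain p.1, is_antichain p.2, p.1 :|: p.2 == T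
             & p.1 :&: p.2 != set0]].

(** A chain and an antichain meet in at most one point x.  In their union, the
    chain consists of the points comparable to x and the antichain of x and the
    points that are not, so x determines the pair. *)
Lemma card_crossings T : (#|crossings T| <= #|T|)%N.
Proof.
pose f (x : P) := ([set y in T | (x >=< y)%O],
                   x |: [set y in T | ~~ (x >=< y)%O]).
apply: leq_trans (leq_imset_card f T); apply/subset_leq_card/subsetP => -[C A].
rewrite inE /= => /and4P[hC hA /eqP TE /set0Pn[x /setIP[xC xA]]].
apply/imsetP; exists x; first by rewrite -TE inE xC.
have nA y : y \in A -> (x >=< y)%O -> y = x.
  by move=> yA xy; apply/esym; apply: (is_antichainP _ hA).
have nC y : y \in C -> (x >=< y)%O by move=> yC; apply: (is_chainP _ hC).
congr pair; apply/setP => y; rewrite -TE !inE.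
  have [/nC->//|yC /=] := boolP (y \in C).
  apply/esym/negbTE; apply: contra yC => /andP[yA xy].
  by rewrite (nA _ yA xy).
have [->|yx] := eqVneq y x; first by rewrite xA.
have [yA|yA] := boolP (y \in A); last by have [/nC->|] := boolP (y \in C).
by rewrite orbT /=; apply/esym; apply: contraNN yx => xy; rewrite (nA _ yA xy).
Qed.

(** The pairs with union T number at most #|T| + (#|T| + 1), by the two
    preceding bounds.  Pairing T with its complement gives the sum over T. *)
Lemma card_chains_antichains :
  (#|[set C : {set P} | is_chain C]| * #|[set A : {set P} | is_antichain A]|
     <= #|P|.+1 * 2 ^ #|P|)%N.
Proof.
have sumT : (\sum_(T : {set P}) (#|T| + #|T|.+1) = #|P|.+1 * 2 ^ #|P|)%N.
  transitivity (\sum_(T : {set P}) #|P|.+1)%N; last first.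
    by rewrite sum_nat_const card_all_sets mulnC.
  transitivity (\sum_(T : {set P}) (#|T| + #|~: T|.+1))%N.
    rewrite !big_split /=; congr addn.
    by rewrite (reindex_inj (inv_inj (@setCK P))).
  by apply: eq_bigr => T _; rewrite addnS cardsC.
rewrite -sumT -cardsX -sum1_card.
rewrite (partition_big (fun p => p.1 :|: p.2) predT) //=.
apply: leq_sum => T _.
pose S := [set p : {set P} * {set P} |
  [&& is_chain p.1, is_antichain p.2 & p.1 :|: p.2 == T]].
rewrite (eq_bigl (mem S)) => [|p]; last by rewrite !inE andbA.
rewrite sum1_card -(cardsID (crossings T) S) leq_add //.
  apply: leq_trans (card_crossings T); apply: subset_leq_card.
  exact: subsetIr.
apply: leq_trans (card_splittings T).
have dis p : p \in S :\: crossings T ->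
    p.1 \in splittings T /\ p.2 = T :\: p.1.
  rewrite !inE => /andP[+ /and3P[hC hA /eqP TE]].
  rewrite hC hA TE eqxx /= negbK => /eqP I0.
  have -> : T :\: p.1 = p.2.
    by rewrite -TE setDUl setDv set0U; apply/setDidPl; rewrite -setI_eq0 setIC I0.
  by rewrite hA -TE subsetUl.
rewrite -(card_in_imset (f := fst) (D := mem (S :\: crossings T))).
  by apply/subset_leq_card/subsetP => _ /imsetP[p /dis[pS _] ->].
by move=> [C A] [C' A'] /dis[_ /= ->] /dis[_ /= ->] ->.
Qed.

(** The set [set i; j] is not an antichain. *)
Lemma card_antichains_lt (i j : P) : (i < j)%O ->
  (#|[set A : {set P} | is_antichain A]| < 2 ^ #|P|)%N.
Proof.
move=> ij; rewrite -card_all_sets -cardsT; apply: proper_card.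
rewrite properT; apply/eqP => /setP/(_ [set i; j]); rewrite !inE => /is_antichainP.
move=> /(_ i j); rewrite !inE !eqxx orbT => /(_ isT isT (lt_comparable ij)).
by move=> e; rewrite e ltxx in ij.
Qed.
End Count.

From mathcomp Require Import finmap.
From mathcomp Require Import boolp classical_sets functions cardinality reals.

(** * Faces of sets given by finitely many linear inequalities *)

Section Cardinal.
Local Open Scope classical_set_scope.
Context {T : choiceType} {K : finType} (f : K -> T) (D : {pred K}).

Lemma fset_set_image_seq :
  fset_set (f @` [set` D]) = seq_fset tt [seq f k | k in D].
Proof.
have fI : finite_set (f @` [set` D]) by apply: finite_image.
apply/fsetP => t; rewrite seq_fsetE in_fset_set //.
apply/idP/fintype.imageP => [|[k kD ->]]; last by rewrite inE; exists k.
by rewrite inE => -[k kD <-]; exists k.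
Qed.

Lemma card_fset_set_sub_image (A : set T) :
  A `<=` f @` [set` D] -> (#|` fset_set A| <= #|D|)%N.
Proof.
move=> sA; have fI : finite_set (f @` [set` D]) by apply: finite_image.
apply: leq_trans (_ : #|` fset_set (f @` [set` D])| <= _)%N.
  by apply: fsubset_leq_card; rewrite -fset_set_sub //; apply: sub_finite_set fI.
rewrite fset_set_image_seq size_seq_fset.
by apply: leq_trans (size_undup _) _; rewrite size_map -cardE.
Qed.

Lemma card_fset_set_image :
  {in D &, injective f} -> #|` fset_set (f @` [set` D])| = #|D|.
Proof.
move=> injf; rewrite fset_set_image_seq size_seq_fset undup_id.
  by rewrite size_map -cardE.
by rewrite map_inj_in_uniq ?enum_uniq // => x y; rewrite !mem_enum; apply: injf.
Qed.

End Cardinal.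

Section Dimension.
Local Open Scope classical_set_scope.
Local Open Scope ring_scope.
Context {R : realType} {V : vectType R}.
Implicit Types (A Q F : set V) (U W : {vspace V}) (x y z : V).

(** The span of A - A, the direction space of the affine hull, is
    characterized as the least subspace U containing all differences.  In
    this form dimensions are computed by comparing subspaces. *)
Lemma affdimP A : A !=set0 -> exists U,
  [/\ \dim U = affdim A,
      forall x y, A x -> A y -> x - y \in U
    & forall W, (forall x y, A x -> A y -> x - y \in W) -> (U <= W)%VS].
Proof.
move=> [a Aa].
pose p (k : 'I_(\dim {:V}).+1) := `[< exists x : 'I_k.+1 -> V,
  (forall i, A (x i)) /\ affinely_independent x >].
have p0 : p ord0.
  apply/asboolP; exists (fun=> a); split=> //.
  by rewrite /affinely_independent tuple0 nil_free.
have [k pk kE] : {k : 'I_(\dim {:V}).+1 | p k & affdim A = k}.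
  by apply: (@eq_bigmax_cond _ p (@nat_of_ord _)); apply/card_gt0P; exists ord0.
have kmax (m : 'I_(\dim {:V}).+1) : p m -> (m <= k)%N.
  by move=> pm; rewrite -kE; apply: (@leq_bigmax_cond _ p (@nat_of_ord _)).
have /asboolP[x [Ax fx]] := pk.
set X : seq V := tval [tuple x (lift ord0 i) - x ord0 | i < k] in fx.
have {}fx : free X by [].
have sX : size X = k by rewrite size_tuple.
have AX y : A y -> y - x ord0 \in <<X>>%VS.
  move=> Ay; apply: contraT => yX.
  pose x' (i : 'I_k.+2) := if unlift ord0 i is Some j then
    (if unlift ord0 j is Some l then x (lift ord0 l) else y) else x ord0.
  have x'E : [tuple x' (lift ord0 i) - x' ord0 | i < k.+1] = y - x ord0 :: X :> seq V.
    rewrite -[RHS]/(tval (cons_tuple (y - x ord0)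
      [tuple x (lift ord0 i) - x ord0 | i < k])); congr tval.
    apply/eq_from_tnth => i; rewrite tnth_mktuple /x' liftK unlift_none.
    by case: unliftP => [j|] ->; rewrite ?tnth0 // tnthS tnth_mktuple.
  have fx' : free (y - x ord0 :: X) by rewrite free_cons yX fx.
  have ltk : (k.+1 < (\dim {:V}).+1)%N.
    have /eqP := fx'; rewrite /= sX => <-.
    by rewrite ltnS; apply/dimvS/subvf.
  have := kmax (Ordinal ltk); rewrite /= ltnn; apply.
  apply/asboolP; exists x'; split; last by rewrite /affinely_independent x'E.
  move=> i; rewrite /x'; case: unliftP => [j _|_]; last exact: Ax.
  by case: unliftP => [l _|_]; first exact: Ax.
exists <<X>>%VS; split.
- by rewrite kE; have /eqP-> := fx; rewrite sX.
- move=> y z Ay Az; rewrite (_ : y - z = (y - x ord0) - (z - x ord0)).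
    by apply: memvB; apply: AX.
  by rewrite opprB addrA subrK.
- move=> W AW; apply/span_subvP => _ /mapP[i _ ->].
  by apply: AW; apply: Ax.
Qed.

Lemma affdim0_singleton F : F !=set0 -> affdim F = 0%N -> exists x, F = [set x].
Proof.
move=> F0 dF; have [U [dU FU _]] := affdimP F0; have [x Fx] := F0.
exists x; apply/seteqP; split=> [y Fy|_ ->//]; apply/eqP.
move: dU; rewrite dF => /eqP; rewrite dimv_eq0 => /eqP U0.
by have := FU _ _ Fy Fx; rewrite U0 memv0 subr_eq0.
Qed.

Lemma affdim_set1 x : affdim [set x] = 0%N.
Proof.
have [U [dU _ UW]] := @affdimP [set x] (ex_intro _ x erefl).
apply/eqP; rewrite -leqn0 -dU -[leqRHS](dimv0 V); apply/dimvS/UW => y z -> ->.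
by rewrite subrr mem0v.
Qed.

Lemma vertex_singleton Q F : vertices Q F -> exists2 x, F = [set x] & Q x.
Proof.
move=> [[l [c [_ FE]]] F0 /(affdim0_singleton F0)[x Fx]]; exists x => //.
have : F x by rewrite Fx.
by rewrite FE => -[].
Qed.

(** A functional exposing x and bounded by its value at x on both u and v
    attains this value at u, since u enters x with positive weight. *)
Lemma vertex_extreme Q x u v (e : R) : vertices Q [set x] -> Q u -> Q v ->
  0 < e < 1 -> x = e *: u + (1 - e) *: v -> u = x.
Proof.
move=> [[l [c [lc FE]]] _ _] Qu Qv /andP[e0 e1] xE.
have lx : l x = c by have : [set x] x := erefl; rewrite FE => -[].
have lu := lc _ Qu; have lv := lc _ Qv.
suff : [set x] u by [].
rewrite FE; split=> //=; apply/le_anti; rewrite lu /=.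
rewrite leNgt; apply/negP => lu'; move: lx.
rewrite xE linearD !linearZ /= /GRing.scale /= => /eqP; apply/negP; rewrite lt_eqF //.
have h1 : e * l u < e * c by rewrite ltr_pM2l.
have h2 : (1 - e) * l v <= (1 - e) * c by rewrite ler_pM2l // subr_gt0.
by apply: lt_le_trans (ltr_leD h1 h2) _; rewrite -mulrDl addrC subrK mul1r.
Qed.

Section Inequalities.
Variables (K : finType) (g : K -> 'Hom(V, R^o)) (b : K -> R).
Let Q : set V := [set x | forall k, g k x <= b k].

(** A point satisfying all inequalities strictly is interior, in the form that
    every line through it stays in Q on both sides for a while. *)
Lemma strict_room z v : (forall k, g k z < b k) ->
  exists2 e : R, 0 < e & Q (z + e *: v) /\ Q (z - e *: v).
Proof.
move=> zb; suff [e e0 eP] : exists2 e : R, 0 < e &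
    forall k, k \in enum K -> e * `|g k v| <= b k - g k z.
  have eP' k : e * `|g k v| <= b k - g k z by apply: eP; rewrite mem_enum.
  exists e => //; split=> k; rewrite ?linearB ?linearD linearZ /=.
    rewrite -lerBrDl; apply: le_trans (eP' k); rewrite ler_pM2l //.
    exact: ler_norm.
  rewrite -lerBrDl; apply: le_trans (eP' k); rewrite -mulrN ler_pM2l //.
  by rewrite -normrN ler_norm.
elim: (enum K) => [|k s [e e0 eP]]; first by exists 1.
have r0 : 0 < b k - g k z by rewrite subr_gt0.
have n0 : 0 < 1 + `|g k v| by rewrite ltr_wpDr.
pose e' := (b k - g k z) / (1 + `|g k v|).
have e'0 : 0 < e' by rewrite divr_gt0.
exists (Num.min e e'); first by rewrite lt_min e0.
move=> j; rewrite inE => /orP[/eqP->|js].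
  apply: (@le_trans _ _ (e' * `|g k v|)).
    by rewrite ler_wpM2r // ge_min lexx orbT.
  by rewrite mulrAC ler_pdivrMr // ler_pM2l // lerDr.
by apply: le_trans (eP j js); rewrite ler_wpM2r // ge_min lexx.
Qed.

Lemma affdim_strict z : (forall k, g k z < b k) -> affdim Q = \dim {:V}.
Proof.
move=> zb; have Qz : Q z by move=> k; apply: ltW.
have [U [<- QU _]] := affdimP (ex_intro _ z Qz).
suff -> : U = fullv by [].
apply/vspaceP => v; rewrite memvf; have [e e0 [Qv _]] := strict_room v zb.
have := QU _ _ Qv Qz; rewrite addrC addKr => ev.
by rewrite -(scale1r v) -(mulVf (lt0r_neq0 e0)) -scalerA memvZ.
Qed.

(** A facet F lies in one of the hyperplanes: otherwise averaging points of F
    gives a point of F in the interior of Q, where the exposing functional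
    attains its maximum and hence vanishes, so that F = Q.  The hyperplane then
    cuts out F and nothing more, because the direction space of F has the
    dimension of the kernel of [g k], and the functional exposing F is constant
    along it. *)
Lemma facet_tight z F : (forall k, g k z < b k) -> facets Q F ->
  exists k, F = Q `&` [set x | g k x = b k].
Proof.
move=> zb [[l [c [lc FE]]] F0 dF]; have Qz : Q z by move=> k; apply: ltW.
have dQ := affdim_strict zb; have [x0 Fx0] := F0.
have [k kF] : exists k, forall x, F x -> g k x = b k.
  apply: contrapT => /forallNP nF.
  (* One inequality at a time is made strict, by passing to a midpoint. *)
  have [y Fy yb] : exists2 y, F y & forall k, k \in enum K -> g k y < b k.
    elim: (enum K) => [|k s [y Fy yb]]; first by exists x0.
    have [w [Fw wb]] : exists w, F w /\ g k w <> b k.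
      by have /existsNP[w /not_implyP[? ?]] := nF k; exists w.
    have [Qy ly] : (Q `&` [set x | l x = c]) y by rewrite -FE.
    have [Qw lw] : (Q `&` [set x | l x = c]) w by rewrite -FE.
    have h : 2^-1 + 2^-1 = 1 :> R by lra.
    exists (2^-1 *: y + 2^-1 *: w).
      rewrite FE; split=> [j|] /=.
        by rewrite linearD !linearZ /= /GRing.scale /=; have := Qy j; have := Qw j; lra.
      by rewrite linearD !linearZ /= ly lw -scalerDl h scale1r.
    move=> j js; rewrite linearD !linearZ /= /GRing.scale /=.
    have := Qw j; have := Qy j; move: js; rewrite inE => /orP[/eqP->|/yb].
      move=> Qyk Qwk; have : g k w < b k by rewrite lt_neqAle Qwk andbT; apply/eqP.
      by lra.
    by lra.
  have {}yb k : g k y < b k by apply: yb; rewrite mem_enum.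
  have [Qy ly] : (Q `&` [set x | l x = c]) y by rewrite -FE.
  have l0 v : l v = 0.
    have [e e0 [/lc + /lc]] := strict_room v yb.
    rewrite linearB linearD linearZ /= ly /GRing.scale /= => h1 h2.
    have /eqP : e * l v = 0 by lra.
    by rewrite mulf_eq0 (gt_eqF e0) => /eqP.
  have FQ : F = Q.
    rewrite FE; apply/seteqP; split=> [x [//]|x Qx]; split=> //=.
    by rewrite l0 -ly l0.
  by move: dF; rewrite FQ; lia.
exists k; have [U [dU FU Umin]] := affdimP F0.
have Uker : (U <= lker (g k))%VS.
  by apply: Umin => x y Fx Fy; rewrite memv_ker linearB /= !kF // subrr.
have kerU : (lker (g k) <= U)%VS.
  rewrite -(geq_leqif (dimv_leqif_sup Uker)) dU -ltnS dF dQ ltnNge.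
  apply: contraTN (zb k) => dker; rewrite -leNgt -(kF _ Fx0) le_eqVlt.
  have /eqP kerT : lker (g k) == fullv by rewrite eqEdim subvf.
  have : z - x0 \in lker (g k) by rewrite kerT memvf.
  by rewrite memv_ker linearB /= subr_eq0 eq_sym => ->.
apply/seteqP; split=> x.
  by move=> Fx; split; [move: Fx; rewrite FE => -[] | exact: kF].
move=> [Qx gx]; have : x - x0 \in U.
  by apply: (subvP kerU); rewrite memv_ker linearB /= (kF _ Fx0) gx subrr.
have Ul : (U <= lker (linfun l))%VS.
  apply: Umin => y w; rewrite FE => -[_ ly] [_ lw].
  by rewrite memv_ker linearB /= !lfunE ly lw subrr.
move=> /(subvP Ul); rewrite memv_ker lfunE /= linearB subr_eq0 => /eqP lx.
rewrite FE; split=> //=; rewrite lx.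
by move: Fx0; rewrite FE => -[].
Qed.

Lemma num_facets_le z : (forall k, g k z < b k) -> (num_facets Q <= #|K|)%N.
Proof.
move=> zb; apply: (card_fset_set_sub_image (f := fun k => Q `&` [set x | g k x = b k])).
by move=> F /(facet_tight zb)[k ->]; exists k.
Qed.
End Inequalities.
End Dimension.

(** * Functions on a finite set *)

Section Coordinates.
Local Open Scope classical_set_scope.
Local Open Scope ring_scope.
Context {R : realType} {P : finType}.
Local Notation V := {ffun P -> R^o}.

Definition eval_at (i : P) (x : V) : R^o := x i.
Lemma eval_at_linear i : linear (eval_at i).
Proof. by move=> a x y; rewrite /eval_at !ffunE. Qed.
HB.instance Definition _ i := GRing.isLinear.Build R V R^o _ (eval_at i) (eval_at_linear i).

Definition coordinate i : 'Hom(V, R^o) := linfun (eval_at i).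

Lemma coordinateE i x : coordinate i x = x i.
Proof. by rewrite lfunE. Qed.

Definition indicator (S : {set P}) : V := [ffun i => (i \in S)%:R].

Lemma indicatorE S i : indicator S i = (i \in S)%:R.
Proof. by rewrite ffunE. Qed.

Lemma indicator_inj : injective indicator.
Proof.
move=> S T /ffunP ST; apply/setP => i; have /eqP := ST i.
by rewrite !indicatorE eqr_nat; do 2 case: (_ \in _).
Qed.

Lemma dim_ffun : \dim {: V} = #|P|.
Proof. by rewrite dimvf /dim /= muln1. Qed.

(** The bound 1 is imposed so that e can serve as a proper convex weight. *)
Lemma positive_floor (x : P -> R) :
  exists2 e : R, 0 < e < 1 & forall i, 0 < x i -> e <= x i.
Proof.
exists (\big[Num.min/2^-1]_(i | 0 < x i) x i); last first.
  by move=> i xi; apply: bigmin_le_cond.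
apply/andP; split; first by apply/bigmin_gtP; split=> //; lra.
by apply: le_lt_trans (bigmin_le_id _ _ _ _) _; lra.
Qed.

(** The hypotheses write x as a proper convex combination of u and the
    rescaled remainder. *)
Lemma vertex_peel (Q : set V) x u (e : R) : vertices Q [set x] -> Q u ->
  0 < e < 1 -> Q ((1 - e)^-1 *: (x - e *: u)) -> u = x.
Proof.
move=> vx Qu e01 Qv; apply: (vertex_extreme vx Qu Qv e01).
rewrite scalerA mulfV ?scale1r; first by rewrite addrC subrK.
by case/andP: e01 => _ e1; rewrite subr_eq0 gt_eqF.
Qed.

End Coordinates.

Section Minimal.
Context {disp : Order.disp_t} {P : finPOrderType disp}.
Implicit Types (S A : {set P}).

Definition minimal S : {set P} :=
  [set i in S | [forall j in S, (j <= i)%O ==> (j == i)]].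

Lemma minimal_antichain S : is_antichain (minimal S).
Proof.
apply/is_antichainP => i j; rewrite !inE => /andP[iS /forall_inP iM].
move=> /andP[jS /forall_inP jM] /orP[ij|ji].
  by apply/eqP; have := jM i iS; rewrite ij.
by apply/esym/eqP; have := iM j jS; rewrite ji.
Qed.

Lemma minimal_below S i : i \in S -> exists2 j, j \in minimal S & (j <= i)%O.
Proof.
(* The size of the principal down-set is a strictly increasing rank. *)
move=> iS; pose h (k : P) := #|[set l : P | (l <= k)%O]|.
have [j /andP[jS ji] jM] :=
  @arg_minnP _ i (fun k => (k \in S) && (k <= i)%O) h (introT andP (conj iS (lexx i))).
exists j => //; rewrite inE jS; apply/forall_inP => k kS; apply/implyP => kj.
apply: contraT => nkj; have := jM k; rewrite kS (le_trans kj ji) => /(_ isT).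
rewrite leqNgt => /negP[]; apply: proper_card; apply/properP; split.
  by apply/fintype.subsetP => l; rewrite !inE => lk; apply: le_trans lk kj.
exists j; rewrite inE ?lexx //.
by apply: contra nkj => jk; rewrite eq_le kj.
Qed.

Definition up_closure A : {set P} := [set i | [exists a in A, (a <= i)%O]].

Lemma up_closure_minimal S : (forall i j, i \in S -> (i <= j)%O -> j \in S) ->
  up_closure (minimal S) = S.
Proof.
move=> upS; apply/setP => i; rewrite inE; apply/exists_inP/idP.
  by move=> [a]; rewrite inE => /andP[aS _]; apply: upS.
by move=> /minimal_below[a aM ai]; exists a.
Qed.

End Minimal.

(** * Facets and vertices of the two polytopes *)

Section PosetPolytopes.
Local Open Scope classical_set_scope.
Local Open Scope ring_scope.
Context {R : realType} {disp : Order.disp_t} {P : finPOrderType disp}.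
Local Notation V := {ffun P -> R^o}.
Local Notation chains := [set C : {set P} | is_chain C]%SET.
Local Notation antichains := [set A : {set P} | is_antichain A]%SET.

(** Sending (i, j) to the chain {i, j} is injective on pairs with i <= j,
    because i and j are then its least and greatest elements; the empty chain
    is missed. *)
Lemma card_le_pairs_lt_chains :
  (#|[pred p : P * P | (p.1 <= p.2)%O]| < #|chains|)%N.
Proof.
pose f (p : P * P) := [set p.1; p.2]%SET.
have f_inj : {in [pred p : P * P | (p.1 <= p.2)%O] &, injective f}.
  move=> [i j] [i' j']; rewrite !inE /f /= => ij ij' /finset.setP E.
  move: (E i) (E j) (E i') (E j').
  rewrite !finset.inE !eqxx ?orbT /=.
  move=> /esym/orP Ei /esym/orP Ej /orP Ei' /orP Ej'.
  have le_i : (i' <= i)%O by case: Ei => /eqP->.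
  have le_i' : (i <= i')%O by case: Ei' => /eqP->.
  have le_j : (j <= j')%O by case: Ej => /eqP->.
  have le_j' : (j' <= j)%O by case: Ej' => /eqP->.
  by congr pair; apply/le_anti; rewrite ?le_i ?le_i' ?le_j ?le_j'.
rewrite -(card_in_imset f_inj); apply: proper_card; apply/properP; split.
  apply/fintype.subsetP => C /imsetP[[i j]]; rewrite !inE /= => ij ->.
  apply/is_chainP => a b; rewrite !inE.
  by move=> /orP[]/eqP-> /orP[]/eqP->; rewrite /f ?comparablexx // /Order.comparable ij ?orbT.
exists finset.set0; first by rewrite inE; apply/is_chainP => i j; rewrite !inE.
apply/imsetP => -[[i j] _ /finset.setP/(_ i)]; by rewrite !inE eqxx.
Qed.

Lemma card_max_chains_lt_chains (i : P) :
  (#|[pred C : {set P} | maxset (@is_chain _ P) C]| < #|chains|)%N.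
Proof.
apply: proper_card; apply/properP; split.
  by apply/fintype.subsetP => C; rewrite !inE => /maxsetp.
exists finset.set0; first by rewrite inE; apply/is_chainP => a b; rewrite !inE.
rewrite inE; apply/negP => /maxsetP[_ /(_ [set i]%SET)].
rewrite finset.sub0set => h; have /finset.setP/(_ i) : [set i]%SET = finset.set0.
  by apply: h => //; apply/is_chainP => a b; rewrite !inE => /eqP-> /eqP->; exact: comparablexx.
by rewrite !inE eqxx.
Qed.

(** The diagonal pairs (i, i) stand for the inequalities x_i <= 1, so that the
    inequalities other than x_i >= 0 are counted by nonempty chains. *)
Definition order_index : finType := (P + {p : P * P | (p.1 <= p.2)%O})%type.

Definition order_form (k : order_index) : 'Hom(V, R^o) :=
  match k with
  | inl i => - coordinate i
  | inr p => if (val p).1 == (val p).2 then coordinate (val p).1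
             else coordinate (val p).2 - coordinate (val p).1
  end.

Definition order_bound (k : order_index) : R :=
  if k is inr p then ((val p).1 == (val p).2)%:R else 0.

Lemma order_polytopeE :
  order_polytope R P = [set x | forall k, order_form k x <= order_bound k].
Proof.
apply/seteqP; split=> x /=.
  move=> [x01 xP] [i|[[i j] /= ij]] /=.
    by rewrite opp_lfunE coordinateE oppr_le0; case/andP: (x01 i).
  case: eqP => [_|_]; first by rewrite coordinateE; case/andP: (x01 i).
  by rewrite add_lfunE opp_lfunE !coordinateE subr_le0; apply: xP.
move=> h; split=> [i|i j ij].
  have := h (inl i); have := h (inr (exist _ (i, i) (lexx i))).
  rewrite /= eqxx opp_lfunE !coordinateE oppr_le0.
  by rewrite /is_true => -> ->.
have [->//|nij] := eqVneq i j.
have := h (inr (exist _ (i, j) ij)).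
by rewrite /= (negbTE nij) add_lfunE opp_lfunE !coordinateE subr_le0.
Qed.

Lemma order_interior : exists z : V, forall k, order_form k z < order_bound k.
Proof.
(* An interior point must be strictly decreasing along the order. *)
pose h (k : P) : R := #|[set l : P | (l <= k)%O]%SET|%:R.
have h0 k : 0 < 1 + h k by rewrite ltr_wpDr // ler0n.
exists [ffun i => (1 + h i)^-1] => -[i|[[i j] /= ij]] /=.
  by rewrite opp_lfunE coordinateE ffunE oppr_lt0 invr_gt0.
have hi : 0 < h i by rewrite ltr0n; apply/card_gt0P; exists i; rewrite inE.
case: eqP => [_|nij].
  by rewrite coordinateE ffunE invf_lt1 // ltrDl.
rewrite add_lfunE opp_lfunE !coordinateE !ffunE subr_lt0 ltf_pV2 ?posrE //.
rewrite ltrD2l ltr_nat; apply: proper_card; apply/properP; split.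
  by apply/fintype.subsetP => l; rewrite !inE => li; apply: le_trans li ij.
exists j; rewrite inE ?lexx //.
by apply: contra_notN nij => ji; apply/eqP; rewrite eq_le ij.
Qed.

Definition chain_index : finType := (P + {C : {set P} | maxset (@is_chain _ P) C})%type.

Definition chain_form (k : chain_index) : 'Hom(V, R^o) :=
  match k with
  | inl i => - coordinate i
  | inr C => \sum_(i in val C) coordinate i
  end.

Definition chain_bound (k : chain_index) : R := if k is inr _ then 1 else 0.

Lemma chain_polytopeE :
  chain_polytope R P = [set x | forall k, chain_form k x <= chain_bound k].
Proof.
apply/seteqP; split=> x /=.
  move=> [x0 xC] [i|[C CM]] /=; first by rewrite opp_lfunE coordinateE oppr_le0.
  rewrite sum_lfunE (eq_bigr (fun i => x i)) => [|i _]; first exact: xC.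
  exact: coordinateE.
move=> h; split=> [i|C CM].
  by have := h (inl i); rewrite /= opp_lfunE coordinateE oppr_le0.
have := h (inr (exist _ C CM)); rewrite /= sum_lfunE.
by rewrite (eq_bigr (fun i => x i)) // => i _; rewrite coordinateE.
Qed.

Lemma chain_interior : exists z : V, forall k, chain_form k z < chain_bound k.
Proof.
have h0 : 0 < 1 + #|P|%:R :> R by rewrite ltr_wpDr // ler0n.
exists [ffun i => (1 + #|P|%:R)^-1] => -[i|[C CM]] /=.
  by rewrite opp_lfunE coordinateE ffunE oppr_lt0 invr_gt0.
rewrite sum_lfunE; rewrite (eq_bigr (fun=> (1 + #|P|%:R)^-1)) => [|i _]; last first.
  by rewrite coordinateE ffunE.
rewrite sumr_const -[ltLHS]/((1 + #|P|%:R)^-1 *+ #|C| : R).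
rewrite -(mulr_natl _^-1) ltr_pdivrMr // mul1r.
by rewrite ltr_pwDl // ler_nat max_card.
Qed.

Lemma affdim_order_polytope : affdim (order_polytope R P) = #|P|.
Proof.
have [z zP] := order_interior.
by rewrite order_polytopeE (affdim_strict zP) dim_ffun.
Qed.

Lemma affdim_chain_polytope : affdim (chain_polytope R P) = #|P|.
Proof.
have [z zP] := chain_interior.
by rewrite chain_polytopeE (affdim_strict zP) dim_ffun.
Qed.

Lemma num_facets_order_polytope :
  (num_facets (order_polytope R P) < #|P| + #|chains|)%N.
Proof.
have [z zP] := order_interior; rewrite order_polytopeE.
apply: leq_ltn_trans (num_facets_le zP) _.
by rewrite card_sum card_sig ltn_add2l card_le_pairs_lt_chains.
Qed.

Lemma num_facets_chain_polytope (i : P) :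
  (num_facets (chain_polytope R P) < #|P| + #|chains|)%N.
Proof.
have [z zP] := chain_interior; rewrite chain_polytopeE.
apply: leq_ltn_trans (num_facets_le zP) _.
by rewrite card_sum card_sig ltn_add2l card_max_chains_lt_chains.
Qed.

Lemma chain_sum_le1 (x : V) C : chain_polytope R P x -> is_chain C ->
  \sum_(i in C) (x i : R) <= 1.
Proof.
move=> [x0 xC] hC; have [M MM CM] := @maxset_exists _ (@is_chain _ P) C hC.
apply: le_trans (xC M MM); rewrite [leRHS](big_setID C) /=.
by rewrite (finset.setIidPr CM) lerDl sumr_ge0.
Qed.

(** The support of a point x of the order polytope is a down-set, and peeling
    off its indicator, with a weight below every positive value of x, respects
    all the inequalities.  The zero set is an up-set, generated by the antichain
    of its minimal points. *)
Lemma order_vertex F : vertices (order_polytope R P) F ->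
  exists2 A, is_antichain A & F = [set indicator (~: up_closure A)%SET].
Proof.
move=> vF; have [x FE [x01 xP]] := vertex_singleton vF.
exists (minimal [set i | x i == 0 :> R]%SET); first exact: minimal_antichain.
rewrite up_closure_minimal; last first.
  move=> i j; rewrite !inE => /eqP xi0 ij; rewrite eq_le.
  by case/andP: (x01 j) => -> _; rewrite -xi0 xP.
rewrite FE in vF *; congr [set _]; apply/esym.
have [e /andP[e0 e1] eP] := positive_floor (fun i => x i : R).
have xi i : x i = 0 \/ 0 < (x i : R).
  by case/andP: (x01 i); rewrite le_eqVlt => /orP[/eqP<-|]; [left|right].
have S i : (i \in ~: [set i | x i == 0 :> R])%SET = (0 < (x i : R)).
  by rewrite !inE; case/andP: (x01 i) => xi0 _; rewrite lt_neqAle eq_sym xi0 andbT.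
have e1' : 0 < 1 - e by rewrite subr_gt0.
have w01 i : 0 <= x i - e * (0 < (x i : R))%R%:R <= 1 - e.
  have [_ xi1] := andP (x01 i); have [xi0|xi0] := xi i.
    by rewrite xi0 ltxx mulr0 subr0 lexx ltW.
  by rewrite xi0 mulr1 subr_ge0 eP // lerD2r.
apply: (vertex_peel (e := e) vF); last 2 first.
- by rewrite e0.
- split=> [i|i j ij]; rewrite !ffunE !S /GRing.scale /=.
    case/andP: (w01 i) => w0 w1.
    by rewrite mulrC ler_pdivrMr // mul1r w1 divr_ge0 // ltW.
  rewrite ler_pM2l ?invr_gt0 //; case: (xi j) => [xj0|xj0].
    by rewrite [in leLHS]xj0 ltxx mulr0 subr0; case/andP: (w01 i).
  by have := xP i j ij => xji; rewrite xj0 (lt_le_trans xj0 xji) lerD2r.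
split=> [i|i j ij]; rewrite !indicatorE; first by rewrite ler0n lern1 leq_b1.
rewrite !S ler_nat; case: (ltP 0 (x j : R)) => //= xj0.
by rewrite (lt_le_trans xj0 (xP _ _ ij)).
Qed.

Lemma indicator_in_chain_polytope (A : {set P}) :
  is_antichain A -> chain_polytope R P (indicator A).
Proof.
move=> hA; split=> [i|C /maxsetp/is_chainP hC]; first by rewrite indicatorE ler0n.
rewrite (eq_bigr (fun i => (i \in A)%:R)) => [|i _]; last exact: indicatorE.
have -> : \sum_(i in C) (i \in A)%:R = (\sum_(i in C | i \in A) 1%N)%:R :> R.
  by rewrite natr_sum big_mkcondr; apply: eq_bigr => i _; case: (i \in A).
rewrite lern1 sum1_card; apply/card_le1_eqP => i j; rewrite -!topredE /=.
move=> /andP[iC iA] /andP[jC jA].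
by apply: (is_antichainP _ hA) => //; exact: hC.
Qed.

(** The set A of minimal points of the support of x is peeled off, with a
    weight e below every positive value of x.  Over a maximal chain M that
    meets A, the sum drops from at most 1 to at most 1 - e, as required.  If M misses A, let m be the
    least point of M in the support: some a in A lies below m, and adding a to
    the part of M in the support gives a chain, whose sum is at most 1, so that
    the sum over M was at most 1 - e already. *)
Lemma chain_vertex F : vertices (chain_polytope R P) F ->
  exists2 A, is_antichain A & F = [set indicator A].
Proof.
move=> vF; have [x FE Qx] := vertex_singleton vF; have [x0 _] := Qx.
pose S := [set i | (0 < (x i : R))]%SET; pose A := minimal S.
have hA : is_antichain A by exact: minimal_antichain.
exists A => //; rewrite FE in vF *; congr [set _]; apply/esym.
have [e /andP[e0 e1] eP] := positive_floor (fun i => x i : R).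
have e1' : 0 < 1 - e by rewrite subr_gt0.
have AS i : i \in A -> 0 < (x i : R) by rewrite !inE => /andP[].
apply: (vertex_peel (e := e) vF); first exact: indicator_in_chain_polytope.
  by rewrite e0.
split=> [i|M MM].
  rewrite !ffunE /GRing.scale /= mulr_ge0 ?invr_ge0 ?(ltW e1') //.
  have [iA|_] := boolP (i \in A); last by rewrite mulr0 subr0.
  by rewrite mulr1 subr_ge0 eP // AS.
rewrite (eq_bigr (fun i => (1 - e)^-1 * ((x i : R) - e * (i \in A)%:R))); last first.
  by move=> i _; rewrite !ffunE.
rewrite -mulr_sumr mulrC ler_pdivrMr // mul1r.
have hM : is_chain M by exact: maxsetp MM.
have [/exists_inP[a aM aA]|nA] := boolP [exists a in M, a \in A].
  have MA i : i \in M -> (i \in A) = (i == a).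
    move=> iM; apply/idP/eqP => [iA|->//].
    by apply: (is_antichainP _ hA) => //; apply: (is_chainP _ hM).
  rewrite (eq_bigr (fun i => (x i : R) - e * (i == a)%:R)) => [|i iM]; last first.
    by rewrite MA.
  rewrite sumrB -mulr_sumr lerB ?chain_sum_le1 //.
  rewrite (bigD1 a) //= eqxx big1 ?addr0 ?mulr1 // => i /andP[_ /negbTE->] //.
have nMA i : i \in M -> i \notin A.
  by move=> iM; apply: contraNN nA => iA; apply/exists_inP; exists i.
rewrite (eq_bigr (fun i => x i : R)) => [|i iM]; last first.
  by rewrite (negbTE (nMA i iM)) mulr0 subr0.
have [MS0|[m0 m0MS]] := set_0Vmem (M :&: S)%SET.
  rewrite big1 ?ltW // => i iM; apply/le_anti; rewrite x0 andbT.
  rewrite leNgt; apply/negP => xi0; move/finset.setP/(_ i): MS0.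
  by rewrite !inE iM xi0.
have [m mMS _] := minimal_below m0MS.
have mP i : i \in M -> 0 < (x i : R) -> (m <= i)%O.
  move: mMS; rewrite !inE => /andP[/andP[mM xm0] /forall_inP mmin] iM xi0.
  have /orP[//|im] := is_chainP _ hM m i mM iM.
  by have /eqP<- : i == m by apply: (implyP (mmin i _) im); rewrite !inE iM xi0.
have [mM mS] : m \in M /\ m \in S.
  by move: mMS; rewrite !inE => /andP[/andP[-> ->]].
have [a aA am] := minimal_below mS.
have aM : a \notin M by apply/negP => /nMA; rewrite aA.
pose C := (a |: [set i in M | 0 < (x i : R)])%SET.
have hC : is_chain C.
  have am' i : i \in M -> 0 < (x i : R) -> (a <= i)%O.
    by move=> iM xi0; apply: le_trans am (mP i iM xi0).
  apply/is_chainP => i j; rewrite !inE.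
  case/predU1P => [->|/andP[iM xi0]] /predU1P[->|/andP[jM xj0]].
  - exact: comparablexx.
  - by rewrite /Order.comparable am'.
  - by rewrite /Order.comparable am' ?orbT.
  - exact: (is_chainP _ hM).
have := chain_sum_le1 Qx hC.
rewrite big_setU1 /=; last by rewrite !inE negb_and aM.
rewrite (_ : \sum_(i in [set i in M | 0 < (x i : R)]%SET) (x i : R) =
             \sum_(i in M) (x i : R)); last first.
  rewrite [RHS](bigID (fun i => 0 < (x i : R))) /= addrC [X in _ = X + _]big1 ?add0r.
    by apply: eq_bigl => i; rewrite inE.
  move=> i /andP[_]; rewrite -leNgt => xi0.
  by apply/le_anti; rewrite xi0 x0.
have := eP a (AS a aA); lra.
Qed.

End PosetPolytopes.

(** * The unit box *)

Section Box.
Local Open Scope classical_set_scope.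
Local Open Scope ring_scope.
Context {R : realType} {P : finType}.
Local Notation V := {ffun P -> R^o}.

Definition box : set V := [set x : V | forall i, 0 <= (x i : R) <= 1].

Definition box_form (k : P * bool) : 'Hom(V, R^o) :=
  if k.2 then coordinate k.1 else - coordinate k.1.

Definition box_bound (k : P * bool) : R := k.2%:R.

Definition box_facet (k : P * bool) : set V :=
  box `&` [set x | box_form k x = box_bound k].

Lemma boxE : box = [set x | forall k, box_form k x <= box_bound k].
Proof.
apply/seteqP; split=> x /= h.
  by case=> i [] /=; have /andP[? ?] := h i; rewrite /box_form /= ?opp_lfunE coordinateE ?oppr_le0.
move=> i; have := h (i, true); have := h (i, false).
by rewrite /box_form /= opp_lfunE coordinateE oppr_le0 => -> ->.
Qed.

Lemma box_facetE i b : box_facet (i, b) = box `&` [set x | x i = b%:R].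
Proof.
rewrite /box_facet /box_form /box_bound /=; congr setI; apply/seteqP.
by case: b; split=> x /=; rewrite ?opp_lfunE coordinateE // => /eqP;
  rewrite ?oppr_eq0 => /eqP // ->; rewrite oppr0.
Qed.

Lemma indicator_in_box (S : {set P}) : box (indicator S).
Proof. by move=> i; rewrite indicatorE; case: (_ \in _); rewrite ?lexx ler01. Qed.

Lemma indicator_box_facet i b (S : {set P}) :
  box_facet (i, b) (indicator S) <-> (i \in S) = b.
Proof.
rewrite box_facetE; split=> [[_ /= /eqP]|<-]; last first.
  by split; [exact: indicator_in_box | rewrite /= indicatorE].
by rewrite indicatorE eqr_nat; case: b (i \in S) => [] [].
Qed.

(** The facet (i, b) contains the 0/1 point with value b at i and [~~ c]
    elsewhere, which lies in the facet (j, c) only if (j, c) = (i, b). *)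
Lemma box_facet_inj : injective box_facet.
Proof.
move=> [i b] [j c] E; pose S := [set l | if l == i then b else ~~ c]%SET.
have Si : (i \in S) = b by rewrite inE eqxx.
have /indicator_box_facet : box_facet (j, c) (indicator S).
  by rewrite -E; apply/indicator_box_facet.
rewrite inE; case: eqP => [->|_] => [->//|]; by case: (c).
Qed.

Lemma box_interior k : box_form k [ffun => 2^-1] < box_bound k.
Proof.
rewrite /box_form /box_bound; case: k => i [] /=; rewrite ?opp_lfunE coordinateE ffunE /=; lra.
Qed.

Lemma affdim_box : affdim box = #|P|.
Proof. by rewrite boxE (affdim_strict box_interior) dim_ffun. Qed.

(** The differences of 0/1 points of the facet contain every basis vector but
    the i-th; adding that one fills the whole space, so the codimension is at
    most one. *)
Lemma affdim_box_facet k : (affdim (box_facet k)).+1 = #|P|.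
Proof.
case: k => i b.
have FS (S : {set P}) : (i \in S) = b -> box_facet (i, b) (indicator S).
  by move=> ?; apply/indicator_box_facet.
have [|U [<- FU Umin]] := @affdimP _ _ (box_facet (i, b)).
  (* The constant 0/1 point with value b. *)
  by exists (indicator [set l | b]%SET); apply: FS; rewrite inE.
have ei_ker : indicator [set i]%SET \notin U.
  have Uk : (U <= lker (coordinate (R := R) i))%VS.
    apply: Umin => x z; rewrite !box_facetE => -[_ xi] [_ zi].
    by rewrite memv_ker linearB /= !coordinateE xi zi subrr.
  apply/negP => /(subvP Uk).
  by rewrite memv_ker coordinateE indicatorE inE eqxx oner_eq0.
have ej j : j != i -> indicator [set j]%SET \in U.
  move=> ji; pose S := [set l in [set i] | b]%SET.
  rewrite (_ : indicator _ = indicator (j |: S)%SET - indicator S :> V).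
    by apply: FU; apply: FS; rewrite !inE ?eqxx // eq_sym (negbTE ji).
  apply/ffunP => l; rewrite !ffunE !inE.
  by case: eqP => [->|_] /=; rewrite ?(negbTE ji) ?subr0 ?subrr.
have Ufull : (U + <[indicator [set i]%SET]>)%VS = fullv.
  apply/vspaceP => v; rewrite memvf.
  rewrite (_ : v = \sum_j v j *: indicator [set j]%SET).
    apply: memv_suml => j _; apply: memvZ; have [->|/ej jU] := eqVneq j i.
      by apply: (subvP (addvSr _ _)); apply: memv_line.
    by apply: (subvP (addvSl _ _)).
  apply/ffunP => l; rewrite sum_ffunE (bigD1 l) //= big1 => [|j jl].
    by rewrite !ffunE inE eqxx addr0 /GRing.scale /= mulr1.
  by rewrite !ffunE inE eq_sym (negbTE jl) scaler0.
apply/eqP; rewrite eqn_leq; apply/andP; split; rewrite -(@dim_ffun R).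
  rewrite ltn_neqAle (dimvS (subvf U)) andbT; apply: contraNN ei_ker => /eqP dU.
  by have /eqP-> : U == fullv; [rewrite eqEdim subvf dU /= | exact: memvf].
rewrite -Ufull; apply: leq_trans (dimv_add_leqif _ _) _.
by rewrite -[leqRHS]addn1 leq_add2l dim_vline; case: (_ != _).
Qed.

Lemma num_facets_box : num_facets box = (2 * #|P|)%N.
Proof.
rewrite mulnC -card_bool -card_prod -(card_fset_set_image (f := box_facet)).
  congr (#|` fset_set _|); apply/seteqP; split=> F.
    rewrite {1}boxE => /(facet_tight box_interior)[k ->]; exists k => //.
    by rewrite /box_facet boxE.
  move=> [k _ <-]; split.
  - exists (box_form k), (box_bound k); split=> //.
    by rewrite boxE => x; apply.
  - case: k => i b; exists (indicator [set l | b]%SET).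
    by apply/indicator_box_facet; rewrite inE.
  - by rewrite affdim_box_facet affdim_box.
by move=> x y _ _; apply: box_facet_inj.
Qed.

(** The functional with coefficient 1 on S and -1 off S attains its maximum
    over the box, coordinate by coordinate, at the indicator of S only. *)
Lemma indicator_vertex_box (S : {set P}) : vertices box [set indicator S].
Proof.
split; last exact: affdim_set1; last by exists (indicator S).
pose l : 'Hom(V, R^o) := \sum_i (-1) ^+ (i \notin S) *: coordinate i.
have lE x : l x = \sum_i (-1) ^+ (i \notin S) * (x i : R).
  by rewrite sum_lfunE; apply: eq_bigr => i _; rewrite scale_lfunE coordinateE.
have term i (x : V) : box x ->
    (-1) ^+ (i \notin S) * (x i : R) <= (-1) ^+ (i \notin S) * (indicator S i : R)
      ?= iff (x i == indicator S i).
  move=> /(_ i)/andP[x0 x1]; rewrite indicatorE; case: (i \in S) => /=.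
    by rewrite !expr0 !mul1r; apply/leifP; case: eqVneq => // ne; rewrite lt_neqAle ne.
  rewrite !expr1 !mulN1r; apply/leifP; rewrite eqr_opp; case: eqVneq => // ne.
  by rewrite ltrN2 lt_neqAle eq_sym ne.
have lS x : box x -> l x <= l (indicator S) ?= iff [forall i, x i == indicator S i].
  by move=> bx; rewrite !lE; apply: leif_sum => i _; apply: term.
exists l, (l (indicator S)); split=> [x /lS[]//|].
apply/seteqP; split=> x /=; first by move=> ->; split=> //; apply: indicator_in_box.
by move=> [/lS[_ +] lx] => /esym; rewrite lx eqxx => /forallP xS; apply/ffunP => i; apply/eqP.
Qed.

End Box.

Section Cube.
Local Open Scope classical_set_scope.
Local Open Scope ring_scope.
Context {R : realType} {P : finType}.
Local Notation V := {ffun P -> R^o}.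

(** The linear part of x |-> 2 x - 1. *)
Definition to_cube (x : V) : 'rV[R]_#|P| := \row_k (2 * (x (enum_val k) : R)).
Lemma to_cube_linear : linear to_cube.
Proof. by move=> a x y; apply/rowP => k; rewrite !mxE !ffunE mulrDr mulrCA. Qed.
HB.instance Definition _ := GRing.isLinear.Build R V 'rV[R]_#|P| _ to_cube to_cube_linear.

Lemma box_cube : affinely_isomorphic (box : set V) (cube R #|P|).
Proof.
exists to_cube, (const_mx (-1)); split.
- by move=> x bx k; rewrite !mxE; have := bx (enum_val k); lra.
- move=> x y _ _ /rowP E; apply/ffunP => i; have := E (enum_rank i).
  by rewrite !mxE enum_rankK; lra.
- move=> y cy; exists [ffun i => (y 0 (enum_rank i) + 1) / 2].
    by move=> i; rewrite ffunE; have := cy (enum_rank i); lra.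
  by apply/rowP => k; rewrite !mxE ffunE enum_valK; lra.
Qed.
End Cube.

(** * Central symmetry *)

Section Symmetry.
Local Open Scope classical_set_scope.
Local Open Scope ring_scope.

Lemma cube_opp (R : realType) n x : cube R n x -> cube R n (- x).
Proof. by move=> cx i; have := cx i; rewrite !mxE lerN2 lerNl andbC. Qed.

Lemma cube0 (R : realType) n : cube R n 0.
Proof. by move=> i; rewrite mxE lerN10 ler01. Qed.

Lemma cross_polytope_opp (R : realType) n x :
  cross_polytope R n x -> cross_polytope R n (- x).
Proof.
move=> cx y /cube_opp/cx; rewrite (eq_bigr (fun i => y 0 i * (- x) 0 i)) // => i _.
by rewrite !mxE mulNr mulrN.
Qed.

Lemma cross_polytope0 (R : realType) n : cross_polytope R n 0.
Proof. by move=> y _; rewrite big1 ?ler01 // => i _; rewrite mxE mulr0. Qed.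

(** Let c be the preimage of the origin.  If x' is the preimage of the opposite
    of the image of x, then the midpoint of x and x' has image 0, so it is c by
    injectivity on A, and x' = 2 c - x.  Arguing with midpoints avoids
    inverting the linear map, which may fail to be injective off A. *)
Lemma affine_iso_symmetric (R : realType) (V W : vectType R) (A : set V) (B : set W) :
  (forall x y, A x -> A y -> A (2^-1 *: x + 2^-1 *: y)) ->
  B 0 -> (forall y, B y -> B (- y)) -> affinely_isomorphic A B ->
  exists s, forall x, A x -> A (s - x).
Proof.
move=> cvxA B0 BN [L [b [fAB injf surjf]]].
have [c Ac Lc] := surjf _ B0; exists (2 *: c) => x Ax.
have [x' Ax' Lx'] := surjf _ (BN _ (fAB _ Ax)).
suff <- : x' = 2 *: c - x by [].
have /injf : 2^-1 *: x + 2^-1 *: x' \in A by rewrite inE; apply: cvxA.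
move=> /(_ c); rewrite inE => /(_ Ac) <-.
  by rewrite scalerDr !scalerA mulfV ?pnatr_eq0 // !scale1r addrC addKr.
rewrite Lc linearD !linearZ /=.
have -> : L x' = - (L x + b) - b by rewrite -Lx' addrK.
rewrite -scalerDr opprD !addrA subrr add0r -opprD -mulr2n -scaler_nat scalerN.
by rewrite scalerA mulVf ?pnatr_eq0 // scale1r addNr.
Qed.

End Symmetry.

(** * The product of the face numbers *)

Section Main.
Local Open Scope classical_set_scope.
Local Open Scope ring_scope.
Context {R : realType} {disp : Order.disp_t} {P : finPOrderType disp}.
Local Notation V := {ffun P -> R^o}.
Local Notation antichains := [set A : {set P} | is_antichain A]%SET.
Local Notation OP := (order_polytope R P).
Local Notation CP := (chain_polytope R P).

Lemma order_polytope_convex (x y : V) : OP x -> OP y -> OP (2^-1 *: x + 2^-1 *: y).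
Proof.
rewrite order_polytopeE => hx hy k; rewrite linearD !linearZ /= /GRing.scale /=.
by have := hx k; have := hy k; lra.
Qed.

Lemma chain_polytope_convex (x y : V) : CP x -> CP y -> CP (2^-1 *: x + 2^-1 *: y).
Proof.
rewrite chain_polytopeE => hx hy k; rewrite linearD !linearZ /= /GRing.scale /=.
by have := hx k; have := hy k; lra.
Qed.

(** The constants 0 and 1 belong to the polytope, which forces s = 1; but if
    i < j, subtracting from 1 the indicator of the down-set of i gives a point
    with value 0 at i and 1 at j. *)
Lemma order_symmetric_antichain (s : V) : (forall x, OP x -> OP (s - x)) ->
  forall i j : P, ~~ (i < j)%O.
Proof.
move=> sym.
have ind (S : {set P}) : (forall i j, (i <= j)%O -> j \in S -> i \in S) -> OP (indicator S).
  move=> hS; split=> [i|i j ij]; rewrite !indicatorE.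
    by case: (_ \in _); rewrite ?lexx ler01.
  by rewrite ler_nat; case: (boolP (j \in S)) => // /(hS _ _ ij)->.
have s1 l : s l = 1.
  have [/(_ l) + _] : OP (s - indicator [set: P]%SET) by apply/sym/ind => ? ?; rewrite !inE.
  have [/(_ l) + _] : OP (s - indicator finset.set0) by apply/sym/ind => ? ?; rewrite !inE.
  rewrite !ffunE !inE subr0 subr_ge0 => /andP[_ s1] /andP[s1' _].
  by apply/le_anti; rewrite s1.
move=> i j; apply/negP => ij.
have [_ /(_ i j (ltW ij))] : OP (s - indicator [set l | (l <= i)%O]%SET).
  by apply/sym/ind => a b ab; rewrite !inE; apply: le_trans.
by rewrite !ffunE !inE lexx !s1 (lt_geF ij) subrr subr0 ler10.
Qed.

(** The unit vectors belong to the polytope, so every coordinate of s is at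
    least 1.  The reflection of 0, which is s, also belongs to it, but the sum
    of s over a chain with two elements is at least 2. *)
Lemma chain_symmetric_antichain (s : V) : (forall x, CP x -> CP (s - x)) ->
  forall i j : P, ~~ (i < j)%O.
Proof.
move=> sym i j; apply/negP => ij.
have s1 l : 1 <= (s l : R).
  have [/(_ l) + _] : CP (s - indicator [set l]%SET).
    apply/sym/indicator_in_chain_polytope/is_antichainP => a b.
    by rewrite !inE => /eqP-> /eqP->.
  by rewrite !ffunE inE eqxx subr_ge0.
have Qs : CP s.
  rewrite -[s]subr0; apply: sym; rewrite chain_polytopeE => k.
  by rewrite linear0 /chain_bound; case: k => _; rewrite ?ler01.
have : \sum_(l in [set i; j]%SET) (s l : R) <= 1.
  apply: chain_sum_le1 => //; apply/is_chainP => a b; rewrite !inE.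
  by move=> /orP[]/eqP-> /orP[]/eqP->; rewrite ?comparablexx // /Order.comparable (ltW ij) ?orbT.
rewrite big_setU1 ?inE ?(lt_eqF ij) //= big_set1.
by have := s1 i; have := s1 j; lra.
Qed.

Lemma num_vertices_order_polytope : (num_vertices OP <= #|antichains|)%N.
Proof.
apply: (card_fset_set_sub_image
  (f := fun A => [set indicator (~: up_closure A)%SET] : set V)).
by move=> F /order_vertex[A hA ->]; exists A => //=; rewrite inE.
Qed.

Lemma num_vertices_chain_polytope : (num_vertices CP <= #|antichains|)%N.
Proof.
apply: (card_fset_set_sub_image (f := fun A => [set indicator A] : set V)).
by move=> F /chain_vertex[A hA ->]; exists A => //=; rewrite inE.
Qed.

(** With n = #|P|, v * f <= a * (n - 1) + a * c, where the first term is
    strictly below (n - 1) * 2 ^ n and the second is at most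
    (n + 1) * 2 ^ n. *)
Lemma face_product_lt (i j : P) v f : (i < j)%O -> (v <= #|antichains|)%N ->
  (f < #|P| + #|[set C : {set P} | is_chain C]%SET|)%N -> (v * f < #|P| * 2 ^ #|P|.+1)%N.
Proof.
move=> ij va fc; have aN := card_antichains_lt ij.
have ca := @card_chains_antichains _ P.
have n2 : (1 < #|P|)%N.
  apply: leq_trans (max_card [set i; j]%SET).
  by rewrite cards2 (lt_eqF ij).
rewrite expnS; move: ca aN va fc n2; move: #|_| #|antichains| #|P| => c a n.
move: (2 ^ n)%N => N ca aN va fc n2.
apply: leq_ltn_trans (leq_mul va (_ : f <= n.-1 + c)%N) _; first by lia.
rewrite mulnDr [(a * c)%N]mulnC.
have : (a * n.-1 < N * n.-1)%N by rewrite ltn_pmul2r //; lia.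
by nia.
Qed.

Section Antichain.
Hypothesis nlt : forall i j : P, ~~ (i < j)%O.

Lemma order_polytope_box : OP = box.
Proof.
apply/seteqP; split=> x; first by case.
move=> bx; split=> // i j; rewrite le_eqVlt (negbTE (nlt i j)) orbF => /eqP->.
exact: lexx.
Qed.

Lemma chain_polytope_box : CP = box.
Proof.
apply/seteqP; split=> x.
  move=> Qx; have [x0 _] := Qx; move=> i; rewrite x0 /=.
  have <- : \sum_(j in [set i]%SET) (x j : R) = x i by rewrite big_set1.
  apply: chain_sum_le1 => //.
  by apply/is_chainP => a b; rewrite !inE => /eqP-> /eqP->; apply: comparablexx.
move=> bx; split=> [i|C /maxsetp/is_chainP hC]; first by case/andP: (bx i).
have [->|[i iC]] := set_0Vmem C; first by rewrite big_set0 ler01.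
rewrite (_ : C = [set i]%SET) ?big_set1; first by case/andP: (bx i).
apply/finset.setP => j; rewrite inE; apply/idP/eqP => [jC|->//].
by have := hC i j iC jC; rewrite /Order.comparable !le_eqVlt !(negbTE (nlt _ _)) !orbF
  => /orP[]/eqP.
Qed.

Lemma num_vertices_box : num_vertices (box : set V) = (2 ^ #|P|)%N.
Proof.
rewrite -(card_all_sets P) -(card_fset_set_image (f := fun S => [set indicator S] : set V)).
  congr (#|` fset_set _|); apply/seteqP; split=> F.
    rewrite -{1}order_polytope_box => /order_vertex[A _ ->].
    by exists (~: up_closure A)%SET.
  by move=> [S _ <-]; apply: indicator_vertex_box.
move=> S T _ _ /seteqP[/(_ (indicator S) erefl) /= h _]; exact: indicator_inj h.
Qed.

Lemma antichain_product Q : Q = OP \/ Q = CP ->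
  (num_vertices Q * num_facets Q = #|P| * 2 ^ #|P|.+1)%N.
Proof.
move=> QE; have -> : Q = box.
  by case: QE => ->; rewrite ?order_polytope_box ?chain_polytope_box.
by rewrite num_vertices_box num_facets_box expnS mulnCA [RHS]mulnCA [(_ * #|P|)%N]mulnC.
Qed.
End Antichain.
End Main.

Theorem lemma14 (R : realType) (disp : Order.disp_t) (P : finPOrderType disp)
    (Q : set {ffun P -> R^o})
    (hQ : Q = order_polytope R P \/ Q = chain_polytope R P)
    (d : nat) (hd : d = affdim Q) :
  (num_vertices Q * num_facets Q <= d * 2 ^ d.+1)%N /\
  ((num_vertices Q * num_facets Q)%N = (d * 2 ^ d.+1)%N <->
   affinely_isomorphic Q (cube R d) \/
   affinely_isomorphic Q (cross_polytope R d)).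
Proof.
have dE : d = #|P|.
  by rewrite hd; case: hQ => ->;
    rewrite ?affdim_order_polytope ?affdim_chain_polytope.
subst d; rewrite dE.
have [/forallP nlt|] := boolP [forall i : P, forall j : P, ~~ (i < j)%O].
  have {}nlt (i j : P) : ~~ (i < j)%O by have /forallP := nlt i; apply.
  rewrite (antichain_product nlt hQ); split=> //; split=> // _; left.
  have -> : Q = box; last exact: box_cube.
  by case: hQ => ->; [exact: order_polytope_box | exact: chain_polytope_box].
move=> /forallPn[i /forallPn[j /negPn ij]].
have Qlt : (num_vertices Q * num_facets Q < #|P| * 2 ^ #|P|.+1)%N.
  apply: (face_product_lt ij); first by case: hQ => ->;
    [exact: num_vertices_order_polytope | exact: num_vertices_chain_polytope].
  case: hQ => ->; first exact: num_facets_order_polytope.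
  exact: num_facets_chain_polytope.
split; first exact: ltnW.
split=> [E|iso]; first by rewrite E ltnn in Qlt.
have [s Qs] : exists s, forall x, Q x -> Q (s - x)%R.
  have cvxQ x y : Q x -> Q y -> Q (2^-1 *: x + 2^-1 *: y)%R.
    by case: hQ => ->;
      [exact: order_polytope_convex | exact: chain_polytope_convex].
  case: iso => [|]; apply: affine_iso_symmetric => //.
  - exact: cube0.
  - exact: cube_opp.
  - exact: cross_polytope0.
  - exact: cross_polytope_opp.
have := ij; rewrite -[(i < j)%O]negbK; case/negP.
case: hQ => QE; rewrite QE in Qs.
  exact: order_symmetric_antichain Qs i j.
exact: chain_symmetric_antichain Qs i j.
Qed.
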